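(* For a finite simple graph $G$ the following statements are equivalent: (1) $G$ admits a $\{{}^rP_3, {}^bP_3, {}^{rrb}K_3, {}^{rbb}K_3\}$-free $2$-edge-colouring. (2) $G$ is the line graph of a bipartite graph. (3) $G$ is a $\{\text{claw}, \text{diamond}, \text{odd-hole}\}$-free graph.
   Context: Graphs are finite and simple. A $2$-edge-colouring of $G$ assigns to every edge the colour red or blue (not necessarily properly). For a set $\mathcal F$ of $2$-edge-coloured graphs, a $2$-edge-colouring of $G$ is $\mathcal F$-free if no induced $2$-edge-coloured subgraph is isomorphic (preserving colours) to a member of $\mathcal F$. Patterns on three vertices: ${}^rP_3$ (resp. ${}^bP_3$) is the path on three vertices with both edges red (resp. blue); ${}^{rrb}K_3$ is the triangle with two red edges and one blue edge; ${}^{rbb}K_3$ is the triangle with one red edge and two blue edges. The line graph of $H$ has vertex set $E(H)$, two vertices being adjacent iff the corresponding edges share an endpoint. For uncoloured graphs, being free of a set of graphs means containing no induced subgraph isomorphic to a member. The claw is $K_{1,3}$; the diamond is $K_4$ minus one edge; an odd-hole is a chordless cycle of odd length at least $5$. *)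

(* Defs.v *)
From mathcomp Require Import all_boot.

Set Implicit Arguments.
Unset Strict Implicit.
Unset Printing Implicit Defensive.

Record sgraph := SGraph {
  vertex :> finType;
  adj : rel vertex;
  adj_sym : symmetric adj;
  adj_irr : irreflexive adj
}.

Section GraphOf.
Variables (T : finType) (r : rel T).

Definition sym_rel : rel T := fun x y => (x != y) && (r x y || r y x).

Lemma sym_rel_sym : symmetric sym_rel.
Proof. by move=> x y; rewrite /sym_rel eq_sym orbC. Qed.

Lemma sym_rel_irr : irreflexive sym_rel.
Proof. by move=> x; rewrite /sym_rel eqxx. Qed.

(* The simple graph on T obtained from r by symmetrizing it and dropping
   loops. *)
Definition graph_of : sgraph := SGraph sym_rel_sym sym_rel_irr.
End GraphOf.

Definition path_graph (n : nat) : sgraph :=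
  graph_of (fun i j : 'I_n => i.+1 == j :> nat).

(* ordS is the successor modulo n; this is the cycle C_n only for n >= 3. *)
Definition cycle_graph (n : nat) : sgraph :=
  graph_of (fun i j : 'I_n => ordS i == j).

Definition complete_graph (n : nat) : sgraph :=
  graph_of (fun _ _ : 'I_n => true).

(* The centre of the claw is the vertex 0. *)
Definition claw : sgraph :=
  graph_of (fun i j : 'I_4 => i == 0 :> nat).

(* The missing edge of the diamond is {0, 1}. *)
Definition diamond : sgraph :=
  graph_of (fun i j : 'I_4 => 1 < j).

Definition graph_iso (G H : sgraph) (f : G -> H) : Prop :=
  bijective f /\ forall x y : G, adj (f x) (f y) = adj x y.

Definition isomorphic (G H : sgraph) : Prop :=
  exists f : G -> H, graph_iso f.

Section Induced.
Variables (G : sgraph) (S : {set G}).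

Definition induced_adj : rel {x : G | x \in S} := fun x y => adj (val x) (val y).

Lemma induced_sym : symmetric induced_adj.
Proof. by move=> x y; rewrite /induced_adj adj_sym. Qed.

Lemma induced_irr : irreflexive induced_adj.
Proof. by move=> x; rewrite /induced_adj adj_irr. Qed.

Definition induced : sgraph := SGraph induced_sym induced_irr.
End Induced.

Definition free (F : sgraph -> Prop) (G : sgraph) : Prop :=
  forall (H : sgraph) (S : {set G}), F H -> ~ isomorphic (induced S) H.

Definition claw_diamond_oddhole (H : sgraph) : Prop :=
  [\/ H = claw,
      H = diamond
    | exists n : nat, [/\ odd n, 5 <= n & H = cycle_graph n]].

Definition edges (G : sgraph) : {set {set G}} :=
  [set [set x; y] | x in G, y in G & adj x y].

Definition edge (G : sgraph) : Type := {e : {set G} | e \in edges G}.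

Definition line_graph (H : sgraph) : sgraph :=
  graph_of (fun e f : edge H => [exists x : H, (x \in val e) && (x \in val f)]).

Definition bipartite (G : sgraph) : Prop :=
  exists A : {set G}, forall x y : G, adj x y -> (x \in A) != (y \in A).

Variant colour := red | blue.

Record ecgraph := ECGraph {
  ecgraph_graph :> sgraph;
  edge_colour : edge ecgraph_graph -> colour
}.

Definition ec_iso (G H : ecgraph) (f : G -> H) : Prop :=
  graph_iso f /\
  forall (e : edge G) (e' : edge H),
    val e' = f @: val e -> edge_colour e' = edge_colour e.

Definition ec_isomorphic (G H : ecgraph) : Prop :=
  exists f : G -> H, ec_iso f.

Lemma induced_edgeP (G : sgraph) (S : {set G}) (e : edge (induced S)) :
  [set val x | x in val e] \in edges G.
Proof.
case: e => e /= /imset2P[x y _]; rewrite inE => xy ->.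
by rewrite imsetU1 imset_set1; apply: imset2_f; rewrite ?inE.
Qed.

(* An edge of an induced subgraph, seen as an edge of the whole graph. *)
Definition induced_edge (G : sgraph) (S : {set G}) (e : edge (induced S)) :
  edge G := exist (fun e => e \in edges G) _ (induced_edgeP e).

Definition ec_induced (G : ecgraph) (S : {set G}) : ecgraph :=
  @ECGraph (induced S) (fun e => edge_colour (induced_edge e)).

Definition ec_free (F : ecgraph -> Prop) (G : ecgraph) : Prop :=
  forall (H : ecgraph) (S : {set G}), F H -> ~ ec_isomorphic (ec_induced S) H.

Definition rP3 : ecgraph := @ECGraph (path_graph 3) (fun _ => red).
Definition bP3 : ecgraph := @ECGraph (path_graph 3) (fun _ => blue).

(* In the two triangles below, the two edges at the vertex 0 share their
   colour, and the edge {1, 2} has the other one. *)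
Definition rrbK3 : ecgraph :=
  @ECGraph (complete_graph 3)
    (fun e => if (ord0 : 'I_3) \in val e then red else blue).
Definition rbbK3 : ecgraph :=
  @ECGraph (complete_graph 3)
    (fun e => if (ord0 : 'I_3) \in val e then blue else red).

Definition bipartite_line_patterns (H : ecgraph) : Prop :=
  [\/ H = rP3, H = bP3, H = rrbK3 | H = rbbK3].

(* Main.v *)
(** All three conditions amount to a splitting of G: a symmetric k on pairs of
    vertices such that, at every vertex y, two distinct neighbours x and z of y
    are adjacent iff [k y x = k y z].  An F-free colouring is literally such a k.
    The classes of the relations "equal, or adjacent with colour b" are the
    vertices of the bipartite root graph, and conversely adjacent edges of a
    bipartite graph are coloured by the side of their common endpoint.
    If G is claw- and diamond-free, every edge lies in a unique maximal clique
    (a line) and every vertex in at most two lines.  An odd cycle of pairwise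
    consecutively meeting lines would give an odd hole through the meeting
    points, so lines can be 2-coloured with meeting lines coloured differently;
    k y x is then the colour of the line through y and x. *)

Require Import Defs.
From HB Require Import structures.
From mathcomp Require Import all_boot zify.

Set Implicit Arguments.
Unset Strict Implicit.
Unset Printing Implicit Defensive.

(** * Induced copies as injective maps *)

Definition is_red (k : colour) : bool := if k is red then true else false.

Lemma is_redK : cancel is_red (fun b => if b then red else blue).
Proof. by case. Qed.

HB.instance Definition _ := Equality.copy colour (can_type is_redK).

Lemma inj_surj_bij (A B : finType) (f : A -> B) :
  injective f -> (forall y, exists x, f x = y) -> bijective f.
Proof.
move=> fI /fin_all_exists[g gK]; exists g => // x.
by apply: fI; rewrite gK.
Qed.

(** The image of an embedding induces a copy of [H], and the inverse of an isomorphism onto [H] is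
    an embedding. This replaces subtypes of [G] by maps into [G]. *)
Lemma free_embed (F : sgraph -> Prop) (G : sgraph) :
  free F G <-> forall H, F H -> forall g : H -> G, injective g ->
    ~ forall x y, adj (g x) (g y) = adj x y.
Proof.
split=> [frG H FH g gI gA | frG H S FH [f [[g fK gK] fA]]].
  have gS (x : H) : g x \in [set g i | i : H] by apply: imset_f.
  pose g' (x : H) : induced [set g i | i : H] :=
    exist (fun z => z \in _) _ (gS x).
  apply: (frG H _ FH).
  have gI' : injective g' by move=> x y [/gI].
  have [|f gK fK] := inj_surj_bij gI'.
    move=> [z zS]; have /imsetP[x _ zE] := zS.
    by exists x; apply: val_inj.
  exists f; split; first by exists g'.
  by move=> x y; rewrite -{2}[x]fK -{2}[y]fK /= -gA.
apply: (frG H FH (fun x => val (g x))) => [x y /val_inj /(can_inj gK) //|x y].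
by rewrite -{2}[x]gK -{2}[y]gK fA.
Qed.

(** Colour of a pair of vertices, [None] on non-edges: one equation between values of [ecol] records
    adjacency and colour together. *)
Definition ecol (G : ecgraph) (x y : G) : option colour :=
  omap (@edge_colour G) (insub [set x; y]).

Lemma mem_edges (G : sgraph) (x y : G) : ([set x; y] \in edges G) = adj x y.
Proof.
apply/idP/idP => [/imset2P[u v _]|xy]; last by apply: imset2_f; rewrite ?inE.
rewrite inE => uv E.
have: u \in [set x; y] by rewrite E !inE eqxx.
have: v \in [set x; y] by rewrite E !inE eqxx orbT.
have: x \in [set u; v] by rewrite -E !inE eqxx.
have: y \in [set u; v] by rewrite -E !inE eqxx orbT.
rewrite !inE.
by do 4![case/orP => /eqP ?]; subst;
  rewrite // ?adj_irr // in uv *; rewrite adj_sym.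
Qed.

Lemma edgesP (G : sgraph) (e : {set G}) :
  reflect (exists x y, adj x y /\ e = [set x; y]) (e \in edges G).
Proof.
apply: (iffP imset2P) => [[x y _]|[x [y [xy ->]]]].
  by rewrite inE => xy ->; exists x, y.
by exists x y; rewrite ?inE.
Qed.

Lemma ecolC (G : ecgraph) (x y : G) : ecol x y = ecol y x.
Proof. by rewrite /ecol setUC. Qed.

Lemma ecol_edge (G : ecgraph) (e : edge G) (x y : G) :
  val e = [set x; y] -> ecol x y = Some (edge_colour e).
Proof. by move=> E; rewrite /ecol -E valK. Qed.

Lemma isSome_ecol (G : ecgraph) (x y : G) : isSome (ecol x y) = adj x y.
Proof.
rewrite -mem_edges /ecol; case: insubP => [e -> //|]; by case: (_ \in _).
Qed.

Lemma ec_free_embed (F : ecgraph -> Prop) (G : ecgraph) :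
  ec_free F G <-> forall H, F H -> forall g : H -> G, injective g ->
    ~ forall x y, ecol (g x) (g y) = ecol x y.
Proof.
split=> [frG H FH g gI gC | frG H S FH [f [[[g fK gK] fA] fC]]].
  have gA (x y : H) : adj (g x) (g y) = adj x y by rewrite -!isSome_ecol gC.
  have gS (x : H) : g x \in [set g i | i : H] by apply: imset_f.
  pose g' (x : H) : induced [set g i | i : H] :=
    exist (fun z => z \in _) _ (gS x).
  apply: (frG H _ FH).
  have gI' : injective g' by move=> x y [/gI].
  have [|f gK fK] := inj_surj_bij gI'.
    move=> [z zS]; have /imsetP[x _ zE] := zS.
    by exists x; apply: val_inj.
  have gf z : g (f z) = val z by rewrite -{2}[z]fK.
  exists f; split; first split; first by exists g'.
    by move=> x y; rewrite -gA !gf.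
  move=> e e' E.
  have /edgesP[x [y [xy E2]]] := valP e.
  have Ee' : val e' = [set f x; f y] by rewrite [LHS]E E2 imsetU1 imset_set1.
  have := ecol_edge Ee'; rewrite -gC !gf => E3.
  have : val (induced_edge e) = [set val x; val y].
    by rewrite /= E2 imsetU1 imset_set1.
  by move/(@ecol_edge G); rewrite E3 => -[].
apply: (frG H FH (fun x => val (g x))) => [x y /val_inj /(can_inj gK) //|x y].
have [xy|] := boolP (adj x y); last first.
  move=> nxy; have : ~~ adj (val (g x)) (val (g y)).
    by rewrite -{1}[x]gK -{1}[y]gK fA in nxy.
  by move: nxy; rewrite -!isSome_ecol; do 2!case: ecol.
have xy' : adj (g x : induced S) (g y) by rewrite -fA !gK.
have e'P : [set x; y] \in edges H by rewrite mem_edges.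
have eP : [set (g x : induced S); g y] \in edges (induced S) by rewrite mem_edges.
pose e' : edge H := exist (fun z => z \in _) _ e'P.
pose e : edge (induced S) := exist (fun z => z \in _) _ eP.
have /= -> := @ecol_edge H e' x y erefl.
rewrite (fC e e') /=; last by rewrite imsetU1 imset_set1 !gK.
by apply: (@ecol_edge G (induced_edge e)); rewrite /= imsetU1 imset_set1.
Qed.

(** * Splittings and colourings avoiding the patterns *)

Definition splitting (G : sgraph) (k : G -> G -> bool) : Prop :=
  (forall x y, k x y = k y x) /\
  forall y x z, adj y x -> adj y z -> x != z -> (k y x == k y z) = adj x z.

Notation o3 i := (@Ordinal 3 i isT).
Notation o4 i := (@Ordinal 4 i isT).

Definition of3 (T : Type) (x y z : T) (i : 'I_3) : T :=
  match val i with 0 => x | 1 => y | _ => z end.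

Lemma ord3P (i : 'I_3) : [\/ i = o3 0, i = o3 1 | i = o3 2].
Proof.
by case: i => [[|[|[|//]]] ?]; [constructor 1|constructor 2|constructor 3];
  apply: val_inj.
Qed.

Lemma of3_inj (T : eqType) (x y z : T) :
  x != y -> x != z -> y != z -> injective (of3 x y z).
Proof.
move=> /eqP xy /eqP xz /eqP yz i j.
by case: (ord3P i) => ->; case: (ord3P j) => -> //=; rewrite /of3 /= => // E;
 exfalso; auto.
Qed.

Lemma adj_neq (G : sgraph) (x y : G) : adj x y -> x != y.
Proof. by apply: contraTneq => ->; rewrite adj_irr. Qed.

Lemma ecolxx (G : ecgraph) (x : G) : ecol x x = None.
Proof. by have := isSome_ecol x x; rewrite adj_irr; case: ecol. Qed.

Lemma ecol_None (G : ecgraph) (x y : G) : adj x y = false -> ecol x y = None.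
Proof. by rewrite -isSome_ecol; case: ecol. Qed.

Lemma ecolE (G : sgraph) (c : {set G} -> colour) (x y : G) :
  @ecol (@ECGraph G (fun e => c (val e))) x y =
  if adj x y then Some (c [set x; y]) else None.
Proof.
rewrite /ecol -mem_edges.
by case: insubP => [e -> /= -> //|/negbTE -> //].
Qed.

(** The bijection [f] names the vertices of the pattern by ['I_3]; three colour equations then
    determine the copy, the other pairs following by symmetry. *)
Lemma pattern_embed (F : ecgraph -> Prop) (G H : ecgraph) (f : 'I_3 -> H)
   (x y z : G) : ec_free F G -> F H -> bijective f ->
  x != y -> x != z -> y != z ->
  ecol x y = ecol (f (o3 0)) (f (o3 1)) ->
  ecol x z = ecol (f (o3 0)) (f (o3 2)) ->
  ecol y z = ecol (f (o3 1)) (f (o3 2)) -> False.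
Proof.
move=> /ec_free_embed frG FH [f' fK f'K] xy xz yz cxy cxz cyz.
apply: (frG H FH (of3 x y z \o f')).
  exact: inj_comp (of3_inj xy xz yz) (can_inj f'K).
move=> u v; rewrite -{2}[u]f'K -{2}[v]f'K /=.
case: (ord3P (f' u)) => ->; case: (ord3P (f' v)) => -> //=;
  by rewrite ?ecolxx // ecolC ?cxy ?cxz ?cyz // ecolC.
Qed.

Lemma bij_id (T : Type) : bijective (@id T).
Proof. by exists id. Qed.

Definition other_colour (k : colour) : colour := if k is red then blue else red.

(** With the colour as a parameter, [P3] and [K3] cover the four patterns in two cases. *)
Definition P3 (k : colour) : ecgraph := @ECGraph (path_graph 3) (fun _ => k).

Definition K3 (k : colour) : ecgraph :=
  @ECGraph (complete_graph 3)
    (fun e => if (ord0 : 'I_3) \in val e then k else other_colour k).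

Lemma patterns_P3 k : bipartite_line_patterns (P3 k).
Proof. by case: k; [constructor 1|constructor 2]. Qed.

Lemma patterns_K3 k : bipartite_line_patterns (K3 k).
Proof. by case: k; [constructor 3|constructor 4]. Qed.

Lemma patternsP H : bipartite_line_patterns H -> exists k, H = P3 k \/ H = K3 k.
Proof.
by case=> ->; [exists red; left | exists blue; left | exists red; right
              | exists blue; right].
Qed.

Lemma ecol_P3 (k : colour) (i j : P3 k) :
  ecol i j = if adj i j then Some k else None.
Proof. exact: (@ecolE (path_graph 3) (fun=> k)). Qed.

Lemma ecol_K3 (k : colour) (i j : 'I_3) :
  @ecol (K3 k) i j =
  if i != j then Some (if (i == ord0) || (j == ord0) then k else other_colour k)
  else None.
Proof.
rewrite (@ecolE (complete_graph 3)
  (fun e => if (ord0 : 'I_3) \in e then k else other_colour k)).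
by rewrite !inE /= /sym_rel andbT ![ord0 == _]eq_sym.
Qed.

Lemma ec_free_P3 (G : ecgraph) (k : colour) (x y z : G) :
  ec_free bipartite_line_patterns G -> x != z ->
  ecol x y = Some k -> ecol y z = Some k -> adj x z.
Proof.
move=> frG xz cxy cyz; apply: contraT => /negbTE /ecol_None cxz; exfalso.
have xy : x != y by apply: adj_neq; rewrite -isSome_ecol cxy.
have yz : y != z by apply: adj_neq; rewrite -isSome_ecol cyz.
by apply: (pattern_embed (f := @id (P3 k)) frG (patterns_P3 k) (bij_id _) xy xz yz);
  rewrite ecol_P3.
Qed.

(** An edge [x z] of the other colour would complete a copy of [K3 k] with [y] as its vertex 0. *)
Lemma ec_free_K3 (G : ecgraph) (k : colour) (x y z : G) :
  ec_free bipartite_line_patterns G -> adj x z ->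
  ecol y x = Some k -> ecol y z = Some k -> ecol x z = Some k.
Proof.
move=> frG xz cyx cyz.
have yx : y != x by apply: adj_neq; rewrite -isSome_ecol cyx.
have yz : y != z by apply: adj_neq; rewrite -isSome_ecol cyz.
move: (xz); rewrite -isSome_ecol; case cxz : ecol => [l|//] _.
suff : l <> other_colour k by case: k l {cyx cyz cxz} => -[].
move=> lE; rewrite {}lE in cxz.
by apply: (pattern_embed (f := @id (K3 k)) frG (patterns_K3 k) (bij_id _) yx yz
  (adj_neq xz)); rewrite ecol_K3.
Qed.

(** Excluding the paths makes equally coloured edges at [y] close up to a triangle; excluding the
    mixed triangles makes every triangle monochromatic. *)
Lemma ec_free_splitting (G : ecgraph) :
  ec_free bipartite_line_patterns G ->
  splitting (fun x y : G => ecol x y == Some red).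
Proof.
move=> frG; split=> [x y|y x z yx yz xz]; first by rewrite ecolC.
have eqE :
    ((ecol y x == Some red) == (ecol y z == Some red)) = (ecol y x == ecol y z).
  move: yx yz; rewrite -!isSome_ecol.
  by case: ecol => [[]|//]; case: ecol => [[]|//].
rewrite {}eqE; apply/eqP/idP => [E|axz].
  move: yz E; rewrite -isSome_ecol; case E: ecol => [k|//] _ E'.
  by apply: (ec_free_P3 frG xz _ E); rewrite ecolC.
move: (yx) (yz) (axz); rewrite -!isSome_ecol.
case cyx : (ecol y x) => [a|//]; case cyz: (ecol y z) => [b|//].
case cxz : (ecol x z) => [d|//] _ _ _.
(* With two colours, two sides of the triangle agree: those meeting at [x], those meeting at [z], or
   else [a = b] already. *)
have [da|/eqP da] := eqVneq (Some d) (Some a).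
  case: da => da; subst d; rewrite -cyz; apply/esym.
  by apply: ec_free_K3 (frG) yz _ cxz; rewrite ecolC.
have [db|/eqP db] := eqVneq (Some d) (Some b).
  case: db => db; subst d; rewrite -cyx ecolC; apply: (ec_free_K3 frG _ (y := z)).
  - by rewrite adj_sym.
  - by rewrite ecolC.
  - by rewrite ecolC.
by case: a b d da db {cyx cyz cxz} => -[] [].
Qed.

Lemma splitting_ec_free (G : sgraph) (k : G -> G -> bool) : splitting k ->
  exists c : edge G -> colour, ec_free bipartite_line_patterns (ECGraph c).
Proof.
move=> [kC kS].
(* An edge is an unordered pair, so its colour is read off from any two distinct elements; the
   symmetry of [k] makes the choice irrelevant. *)
pose c (e : {set G}) :=
  if [exists x in e, exists y in e, (x != y) && k x y] then red else blue.
exists (fun e => c (val e)); apply/ec_free_embed => H /patternsP[l HE] g gI gE.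
have cE x y : adj x y -> c [set x; y] = if k x y then red else blue.
  move=> /adj_neq xy; rewrite /c; case: ifP => [/exists_inP[u]|/negbT].
    rewrite !inE => up /exists_inP[v]; rewrite !inE => vp /andP[uv kuv].
    suff -> : k x y by [].
    by move: up vp uv kuv => /orP[]/eqP-> /orP[]/eqP->; rewrite ?eqxx // kC.
  case: ifP => // kxy /exists_inP; case; exists x; rewrite ?inE ?eqxx //.
  by apply/exists_inP; exists y; rewrite ?xy ?inE ?eqxx ?orbT.
have {}gE (x y : H) : ecol x y =
   if adj (g x) (g y) then Some (if k (g x) (g y) then red else blue) else None.
  rewrite -gE (@ecolE G c); case: ifP => // a; by rewrite cE.
have col m (x y : H) : ecol x y = Some m ->
    adj (g x) (g y) /\ k (g x) (g y) = is_red m.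
  by rewrite gE; case: ifP => // a [<-]; case: (k _ _).
(* Both patterns fail at vertex 1: in [P3] its edges agree but 0 and 2 are not adjacent, in [K3] its
   edges differ but 0 and 2 are adjacent. *)
case: HE => HE; subst H.
  have [|a10 k10] := col l (o3 1) (o3 0); first by rewrite ecol_P3.
  have [|a12 k12] := col l (o3 1) (o3 2); first by rewrite ecol_P3.
  have := kS _ _ _ a10 a12; rewrite k10 k12 eqxx.
  have /esym := gE (o3 0) (o3 2); rewrite ecol_P3.
  case: (adj (g _)) => // _.
  by rewrite (inj_eq gI) => /(_ isT).
have [|a10 k10] := col l (o3 1) (o3 0); first by rewrite ecol_K3.
have [|a12 k12] := col (other_colour l) (o3 1) (o3 2); first by rewrite ecol_K3.
have [|a02 _] := col l (o3 0) (o3 2); first by rewrite ecol_K3.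
have := kS _ _ _ a10 a12; rewrite k10 k12 a02 (inj_eq gI) => /(_ isT).
by case: (l).
Qed.

(** * Splittings and line graphs of bipartite graphs *)

(* The splitting colours xy by whether x and y share their endpoint in A. *)
Lemma line_splitting (G H : sgraph) :
  bipartite H -> isomorphic G (line_graph H) ->
  exists k : G -> G -> bool, splitting k.
Proof.
move=> [A bipA] [f [fb fA]]; have fI := bij_inj fb.
(* [ab x] lists the ends of the edge [f x], the one in [A] first, so two edges can only share first
   ends or second ends. *)
have /fin_all_exists[ab abP] (x : G) : exists ab : H * H,
    [/\ val (f x) = [set ab.1; ab.2], ab.1 \in A & ab.2 \notin A].
  have /edgesP[u [v [uv E]]] := valP (f x).
  have := bipA _ _ uv.
  have [uA|uA] := boolP (u \in A); have [vA|vA] := boolP (v \in A) => // _.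
    by exists (u, v).
  by exists (v, u); rewrite E setUC.
have abI : injective ab.
  by move=> x y E; apply/fI/val_inj;
    case: (abP x) (abP y) => -> _ _ [-> _ _]; rewrite E.
have adjE x y : adj x y =
    (x != y) && (((ab x).1 == (ab y).1) || ((ab x).2 == (ab y).2)).
  rewrite -fA /= /sym_rel (inj_eq fI).
  have -> : [exists z, (z \in val (f y)) && (z \in val (f x))] =
         [exists z, (z \in val (f x)) && (z \in val (f y))].
    by apply: eq_existsb => z; rewrite andbC.
  rewrite orbb; congr andb.
  have [-> xA xA'] := abP x; have [-> yA yA'] := abP y.
  apply/existsP/orP => [[z]|].
    rewrite !inE => /andP[/orP[]/eqP-> /orP[]]; try by [left|right].
      by move=> E; rewrite (eqP E) (negbTE yA') in xA.
    by move=> E; rewrite (eqP E) yA in xA'.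
  case=> /eqP E; [exists (ab x).1|exists (ab x).2];
  by rewrite !inE E !eqxx ?orbT.
exists (fun x y => (ab x).1 == (ab y).1); split=> [x y|y x z]; first exact: eq_sym.
rewrite !adjE -!(inj_eq abI).
case: (ab x) (ab y) (ab z) => [a b] [a' b'] [a'' b''] /=.
rewrite !xpair_eqE.
(* Given transitivity of equality among the first ends and among the second ends, the claim is a
   boolean identity in six equality tests. *)
have eq_trans3 (T : eqType) (u v w : T) :
    [&& (u == v) && (u == w) ==> (v == w), (u == v) && (v == w) ==> (u == w)
      & (u == w) && (v == w) ==> (u == v)].
  by apply/and3P; split; apply/implyP => /andP[/eqP-> /eqP->].
move: (eq_trans3 _ a' a a'') (eq_trans3 _ b' b b'').
by do 6!case: (_ == _).
Qed.

(** A vertex [x] of [G] becomes the edge joining its [true] class to its [false] class. *)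
Lemma splitting_line (G : sgraph) (k : G -> G -> bool) : splitting k ->
  exists H : sgraph, bipartite H /\ isomorphic G (line_graph H).
Proof.
move=> [kC kS].
pose C b (x : G) := [set y | (y == x) || adj x y && (k x y == b)].
have CP b x y : y \in C b x -> C b x = C b y.
  rewrite inE => /orP[/eqP-> //|/andP[xy /eqP kxy]].
  (* Transitivity: the splitting at [v] makes [u] and [w] adjacent, then the splitting at [u] gives
     the edge [u w] the colour [b]. *)
  have half (u v w : G) : adj u v -> k u v = b -> w \in C b v -> w \in C b u.
    rewrite !inE => uv kuv /orP[/eqP->|/andP[vw /eqP kvw]].
      by rewrite uv kuv eqxx orbT.
    have [//|/= wu] := eqVneq w u.
    have vu : adj v u by rewrite adj_sym.
    have uw : adj u w by rewrite -(kS v) // 1?eq_sym // [k v u]kC kuv kvw.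
    have vwn := adj_neq vw.
    by rewrite uw -kuv eq_sym kS.
  apply/setP => z; apply/idP/idP; last exact: half.
  by apply: half; rewrite ?kxy 1?kC // adj_sym.
have Cxx b x : x \in C b x by rewrite inE eqxx.
have CE b x y : (C b x == C b y) = (y \in C b x).
  by apply/eqP/idP => [->|/CP].
(* The tag [b] separates the two sides even when the two classes coincide as sets. Pairs that are
   not of the form [n b x] are isolated in [H] and add no edge. *)
pose n b x := (b, C b x).
pose H := graph_of (fun p q : bool * {set G} =>
  [exists x, (p == n true x) && (q == n false x)]).
have eP x : [set (n true x : H); n false x] \in edges H.
  rewrite mem_edges /= /sym_rel /=; apply/orP; left.
  by apply/existsP; exists x; rewrite !eqxx.
pose f x : line_graph H := exist (fun e => e \in edges H) _ (eP x).
have fE x y : [exists v, (v \in val (f x)) && (v \in val (f y))] =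
    [exists b, y \in C b x].
  apply/existsP/existsP => [[v]|[b]].
    rewrite !inE => /andP[/orP[]/eqP-> /orP[]] /=; rewrite xpair_eqE //= => E.
      by exists true; rewrite -CE.
    by exists false; rewrite -CE.
  rewrite -CE => /eqP E; exists (n b x).
  have nE : n b x = n b y by rewrite /n E.
  by rewrite !inE {3 4}nE; case: (b); rewrite !eqxx ?orbT.
have xyE x y : x != y -> [exists b, y \in C b x] = adj x y.
  move=> xy; apply/existsP/idP => [[b]|axy].
    by rewrite inE eq_sym (negbTE xy) => /andP[].
  by exists (k x y); rewrite inE axy eqxx orbT.
(* Distinct vertices sharing both classes would be joined by an edge of both colours. *)
have fI : injective f.
  move=> x y /(congr1 val) /= E; apply/eqP; apply: contraT => xy.
  have CC b : y \in C b x.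
    have : n b x \in [set n true y; n false y].
      by rewrite -E !inE; case: b; rewrite eqxx ?orbT.
    by rewrite in_set2 -CE => /orP[] /eqP [-> ->].
  move: (CC true) (CC false); rewrite !inE eq_sym (negbTE xy) /=.
  by case: (k x y); rewrite ?andbF.
exists H; split.
  exists [set p | p.1] => p q; rewrite !inE.
  by move=> /andP[_ /orP[]/existsP[x]] /andP[/eqP-> /eqP->].
exists f; split; last first.
  move=> x y; rewrite /= /sym_rel (inj_eq fI).
  have [->|xy] /= := eqVneq x y; first by rewrite adj_irr.
  by rewrite !fE !xyE // 1?eq_sym // [adj y x]adj_sym orbb.
apply: inj_surj_bij => // e.
have /edgesP[p [q [pq E]]] := valP e.
have /andP[_ /orP[]/existsP[x]] := pq => /andP[/eqP pE /eqP qE]; exists x;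
  apply: val_inj; rewrite E pE qE //=; exact: setUC.
Qed.

(** * Splittings exclude claws, diamonds and odd holes *)

Lemma val_ordS n (i : 'I_n.+1) :
  ordS i = (if i == n :> nat then 0 else i.+1) :> nat.
Proof.
rewrite /=; case: eqP => [->|ni]; first by rewrite modnn.
by rewrite modn_small //; have := ltn_ord i; lia.
Qed.

(** The leaves of a claw would need three colours at its centre. In a diamond, the edges from 2 to 0
    and to 1 both agree with the edge from 2 to 3, although 0 and 1 are not adjacent. Around a hole
    the colours alternate. *)
Lemma splitting_free (G : sgraph) (k : G -> G -> bool) : splitting k ->
  free claw_diamond_oddhole G.
Proof.
move=> [kC kS]; apply/free_embed => H + g gI gA.
case => [HE|HE|[n [nodd n5 HE]]]; subst H.
- have := kS (g (o4 0)) (g (o4 1)) (g (o4 2)).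
  have := kS (g (o4 0)) (g (o4 1)) (g (o4 3)).
  have := kS (g (o4 0)) (g (o4 2)) (g (o4 3)).
  rewrite !gA !(inj_eq gI).
  move=> /(_ isT isT isT) + /(_ isT isT isT) + /(_ isT isT isT).
  by do 3!case: (k _ _).
- have := kS (g (o4 2)) (g (o4 0)) (g (o4 1)).
  have := kS (g (o4 2)) (g (o4 0)) (g (o4 3)).
  have := kS (g (o4 2)) (g (o4 1)) (g (o4 3)).
  rewrite !gA !(inj_eq gI).
  move=> /(_ isT isT isT) + /(_ isT isT isT) + /(_ isT isT isT).
  by do 3!case: (k _ _).
case: n => // n in nodd n5 g gI gA *.
pose w i := iter i (@ordS n.+1) ord0.
have w_n : w n.+1 = w 0.
  have wE i : i <= n -> w i = i :> nat.
    elim: i => // i IH lin; rewrite /w iterS val_ordS -/(w i) IH 1?ltnW //.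
    by case: eqP => //; lia.
  by apply: ord_inj; rewrite /w iterS val_ordS -/(w n) wE // eqxx.
have nS (j : 'I_n.+1) : ordS j != j.
  by apply/eqP => /(congr1 (@nat_of_ord _)); rewrite val_ordS; case: eqP; lia.
have nSS (j : 'I_n.+1) : ordS (ordS j) != j.
  by apply/eqP => /(congr1 (@nat_of_ord _)); rewrite !val_ordS; do 2!case: eqP; lia.
(* This rules out the triangle, so that vertices two steps apart on the cycle are not adjacent. *)
have nSSS (j : 'I_n.+1) : ordS (ordS (ordS j)) != j.
  by apply/eqP => /(congr1 (@nat_of_ord _)); rewrite !val_ordS; do 3!case: eqP; lia.
have aS (j : cycle_graph n.+1) : adj j (ordS j).
  by rewrite /= /sym_rel eqxx eq_sym nS.
have aSS (j : cycle_graph n.+1) : adj j (ordS (ordS j)) = false.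
  by rewrite /= /sym_rel (negbTE (nSSS j)) [ordS j == _]eq_sym (negbTE (nS _)) andbF.
have kw i : k (g (w i)) (g (w i.+1)) = odd i (+) k (g (w 0)) (g (w 1)).
  elim: i => [//|i IH]; have := kS (g (w i.+1)) (g (w i)) (g (w i.+2)).
  rewrite !gA !(inj_eq gI) aSS adj_sym aS aS eq_sym nSS => /(_ isT isT isT).
  by rewrite kC IH /=; do 2!case: (k _ _); case: odd.
(* After [n.+1] steps the walk is back at its first edge, while an odd number of alternations has
   flipped the colour. *)
have := kw n.+1; rewrite {1}w_n [w n.+2]iterS -/(w n.+1) w_n -[ordS _]/(w 1) nodd.
by case: (k _ _).
Qed.

(** * Two-colouring a graph without odd cycles *)

Lemma not_uniqP (T : eqType) (s : seq T) : ~~ uniq s ->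
  exists x s1 s2 s3, s = s1 ++ x :: s2 ++ x :: s3.
Proof.
elim: s => //= y s IH; rewrite negb_and negbK => /orP[/splitPr[s2 s3]|/IH].
  by exists y, [::], s2, s3.
by move=> [x [s1 [s2 [s3 ->]]]]; exists x, (y :: s1), s2, s3.
Qed.

(** A repeated vertex cuts a closed walk into two shorter ones, and one of them has odd length. *)
Lemma odd_cycle_uniq (T : eqType) (e : rel T) (p : seq T) :
  cycle e p -> odd (size p) -> exists q, [/\ cycle e q, odd (size q) & uniq q].
Proof.
have [n] := ubnP (size p); elim: n p => // n IH p; rewrite ltnS => pn cp op.
have [up|/not_uniqP[x [s1 [s2 [s3 pE]]]]] := boolP (uniq p); first by exists p.
(* Rotating the walk to start at the first [x] gives the two closed walks [x :: s2] and
   [x :: s3 ++ s1]. *)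
move: cp; rewrite pE -(rot_cycle (size s1)) rot_size_cat /= -catA.
rewrite rcons_cat cat_path rcons_cons /= => /and3P[p2 e2 p31].
move: op pn; rewrite {}pE !size_cat /= size_cat /= => op pn.
have [o2|o2] := boolP (odd (size s2).+1).
  apply: (IH (x :: s2)) => //=; first by lia.
  by rewrite rcons_path p2.
apply: (IH (x :: s3 ++ s1)) => //=; rewrite size_cat; first by lia.
by move: op o2; rewrite /= !(oddD, oddS); do 3!case: (odd _).
Qed.

(** The relation [d] is the bipartite double cover. Without odd closed walks the two lifts of a
    vertex are never connected in it. *)
Lemma odd_cycle_free_bipartition (T : finType) (e : rel T) : symmetric e ->
  (forall p, cycle e p -> odd (size p) -> uniq p -> False) ->
  exists c : T -> bool, forall x y, e x y -> c x != c y.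
Proof.
move=> eC noodd.
pose d : rel (T * bool) := fun u v => e u.1 v.1 && (u.2 != v.2).
have dC : connect_sym d.
  by apply: sym_connect_sym => u v; rewrite /d eC eq_sym.
have d_path u p : path d u p ->
    path e u.1 (map fst p) /\ (last u p).2 = odd (size p) (+) u.2.
  elim: p u => //= v p IH u /andP[/andP[euv uv] /IH[pp ->]]; split.
    by rewrite euv.
  by move: uv; case: odd; case: u.2; case: v.2.
have no_lift x b : ~ connect d (x, b) (x, ~~ b).
  case/connectP => p /d_path[/= pp po] lE.
  have op : odd (size p) by move: po; rewrite -lE /=; case: odd; case: b {lE}.
  suff cp : cycle e (map fst p).
    have := odd_cycle_uniq cp; rewrite size_map => /(_ op)[q []].
    exact: noodd.
  case: p pp lE {po op} => //= v p /andP[xv pp] lE.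
  by rewrite rcons_path pp last_map -lE.
have lift x y : connect e x y -> exists b, connect d (x, false) (y, b).
  case/connectP => p + ->; elim/last_ind: p => [_|p z IH]; first by exists false.
  rewrite rcons_path last_rcons => /andP[/IH[b xb] ez]; exists (~~ b).
  apply: connect_trans xb (connect1 _); rewrite /d ez; by case: b.
have step x y b : e x y -> connect d (x, b) (y, ~~ b).
  by move=> xy; apply: connect1; rewrite /d xy; case: b.
(* The colour of [x] tells whether a walk of even length leads to [x] from the root of its
   component. *)
exists (fun x => connect d (fingraph.root e x, false) (x, false)) => x y exy.
have eCS : connect_sym e by apply: sym_connect_sym.
have /eqP <- : fingraph.root e x == fingraph.root e y.
  by rewrite root_connect // connect1.
set r := fingraph.root e x.
have [cx|ncx] := boolP (connect d (r, false) (x, false)).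
  apply/negP => /eqP/esym cy.
  apply: (no_lift x false); rewrite dC in cx; apply: connect_trans cx _.
  by apply: connect_trans cy _; rewrite dC; apply: (step x y true).
have [|b rb] := @lift r x; first by rewrite eCS connect_root.
case: b rb => rb; last by rewrite rb in ncx.
by rewrite (connect_trans rb (step x y true exy)).
Qed.

(** * Lines in graphs without claws, diamonds and odd holes *)

Definition of4 (T : Type) (x y z t : T) (i : 'I_4) : T :=
  match val i with 0 => x | 1 => y | 2 => z | _ => t end.

Lemma ord4P (i : 'I_4) : [\/ i = o4 0, i = o4 1, i = o4 2 | i = o4 3].
Proof.
by case: i => [[|[|[|[|//]]]] ?]; [constructor 1|constructor 2|constructor 3
  |constructor 4]; apply: val_inj.
Qed.

Lemma free_embed4 (F : sgraph -> Prop) (G : sgraph) (r : rel 'I_4)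
    (x y z t : G) :
  free F G -> F (graph_of r) -> uniq [:: x; y; z; t] ->
  adj x y = sym_rel r (o4 0) (o4 1) -> adj x z = sym_rel r (o4 0) (o4 2) ->
  adj x t = sym_rel r (o4 0) (o4 3) -> adj y z = sym_rel r (o4 1) (o4 2) ->
  adj y t = sym_rel r (o4 1) (o4 3) -> adj z t = sym_rel r (o4 2) (o4 3) -> False.
Proof.
move=> /free_embed frG FH /=; rewrite !inE !negb_or -!andbA.
move=> /and5P[/eqP xy /eqP xz /eqP xt /eqP yz /and3P[/eqP yt /eqP zt _]] a b c d e f.
apply: (frG _ FH (of4 x y z t)) => i j.
  by case: (ord4P i) => ->; case: (ord4P j) => -> //= E; exfalso; auto.
case: (ord4P i) => ->; case: (ord4P j) => ->;
  rewrite /of4 /= ?adj_irr ?sym_rel_irr //;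
  by rewrite adj_sym sym_rel_sym.
Qed.

Section Lines.
Variable G : sgraph.
Hypothesis frG : free claw_diamond_oddhole G.

Lemma claw_free (y a b c : G) : adj y a -> adj y b -> adj y c ->
  a != b -> a != c -> b != c -> [|| adj a b, adj a c | adj b c].
Proof.
move=> ya yb yc ab ac bc; apply: contraT; rewrite !negb_or.
move=> /and3P[/negbTE nab /negbTE nac /negbTE nbc]; exfalso.
apply: (@free_embed4 _ _ _ y a b c frG (Or31 _ _ erefl)).
  by rewrite /= !inE !negb_or ab ac bc (adj_neq ya) (adj_neq yb) (adj_neq yc).
all: by rewrite ?ya ?yb ?yc ?nab ?nac ?nbc.
Qed.

Lemma diamond_free (u v a b : G) : adj u v -> adj u a -> adj v a ->
  adj u b -> adj v b -> a != b -> adj a b.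
Proof.
move=> uv ua va ub vb ab; apply: contraT => /negbTE nab; exfalso.
apply: (@free_embed4 _ _ _ a b u v frG (Or32 _ _ erefl)).
  by rewrite /= !inE !negb_or ab !adj_neq // adj_sym.
all: by rewrite ?nab // adj_sym.
Qed.

Lemma oddhole_free n (x : 'I_n -> G) : odd n -> 5 <= n -> injective x ->
  ~ forall i j, adj (x i) (x j) = (i != j) && ((ordS i == j) || (ordS j == i)).
Proof.
move=> on n5 xI xA; move/free_embed: frG => /(_ (cycle_graph n)).
by apply: (fun H => H (Or33 _ _ _) x xI xA); exists n.
Qed.

(** For adjacent [x] and [y], diamond-freeness makes this the unique maximal clique containing
    both. *)
Definition line (x y : G) : {set G} :=
  [set z | ((z == x) || adj x z) && ((z == y) || adj y z)].

Lemma lineC x y : line x y = line y x.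
Proof. by apply/setP => z; rewrite !inE andbC. Qed.

Lemma line_l x y : adj x y -> x \in line x y.
Proof. by rewrite inE eqxx adj_sym => ->; rewrite orbT. Qed.

(** Two distinct common neighbours of an edge are adjacent by diamond-freeness, so one end of the
    edge may be exchanged for another point of the line. *)
Lemma line_step x y z : adj x y -> z \in line x y -> z != x -> line x z = line x y.
Proof.
have half (a b c w : G) : adj a b -> adj a c -> adj b c ->
    w \in line a b -> w \in line a c.
  move=> ab ac bc; rewrite !inE.
  have [->|wa /=] := eqVneq w a; first by rewrite [adj c a]adj_sym ac orbT.
  move=> /andP[aw]; rewrite aw /=.
  have [->|wb /= bw] := eqVneq w b; first by rewrite [adj c b]adj_sym bc orbT.
  have [//|wc /=] := eqVneq w c.
  by rewrite adj_sym; apply: (diamond_free ab).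
move=> xy; rewrite inE => /andP[]; have [//|zx /= xz] := eqVneq z x.
have [->//|zy /= yz _] := eqVneq z y.
apply/setP => w; apply/idP/idP; apply: half => //; by rewrite adj_sym.
Qed.

(** The ends [x] and [y] are exchanged for [u] and [v] one at a time by [line_step]. *)
Lemma line_eq x y u v : adj x y -> u \in line x y -> v \in line x y -> u != v ->
  adj u v /\ line u v = line x y.
Proof.
move=> xy uL vL uv.
have adjL a b z : z \in line a b -> z != a -> adj a z.
  by rewrite inE => /andP[/orP[-> //|]].
have [ux|ux] := eqVneq u x.
  by subst u; split; [apply: adjL vL _|apply: line_step]; rewrite // eq_sym.
have xu := adjL _ _ _ uL ux; have xuE := line_step xy uL ux.
rewrite -xuE lineC in vL *.
by split; [apply: adjL vL _|apply: line_step]; rewrite // 1?adj_sym 1?eq_sym.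
Qed.

Definition is_line (A : {set G}) := [exists x, exists y, adj x y && (A == line x y)].

Lemma is_lineP A : reflect (exists x y, adj x y /\ A = line x y) (is_line A).
Proof.
apply: (iffP existsP) => [[x /existsP[y /andP[xy /eqP]]]|[x [y [xy ->]]]].
  by exists x, y.
by exists x; apply/existsP; exists y; rewrite xy eqxx.
Qed.

Lemma two_points A u v : is_line A -> u \in A -> v \in A -> u != v ->
  adj u v /\ A = line u v.
Proof.
move=> /is_lineP[x [y [xy ->]]] uA vA uv.
by have [-> ->] := line_eq xy uA vA uv.
Qed.

Lemma line_at A z : is_line A -> z \in A -> exists2 a, adj z a & A = line z a.
Proof.
move=> /is_lineP[x [y [xy ->]]].
have [-> _|zx zA] := eqVneq z x; first by exists y.
have [zxa zxE] := line_eq xy zA (line_l xy) zx.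
by exists x.
Qed.

(** Take a second point on each line. By claw-freeness two of these neighbours of [z] coincide or
    are adjacent, and then they span the same line with [z]. *)
Lemma three_lines A B C z : is_line A -> is_line B -> is_line C ->
  z \in A -> z \in B -> z \in C -> [|| A == B, A == C | B == C].
Proof.
move=> /line_at lA /line_at lB /line_at lC /lA[a za ->] /lB[b zb ->] /lC[c zc ->].
have E u v : adj z u -> adj z v -> adj u v -> line z u = line z v.
  move=> zu zv uv; apply: line_step zv _ _; rewrite ?inE 1?eq_sym ?(adj_neq zu) //.
  by rewrite zu [adj v u]adj_sym uv !orbT.
have [->|ab] := eqVneq a b; first by rewrite eqxx.
have [->|ac] := eqVneq a c; first by rewrite eqxx orbT.
have [->|bc] := eqVneq b c; first by rewrite eqxx !orbT.
have /or3P[/(E _ _ za zb)->|/(E _ _ za zc)->|/(E _ _ zb zc)->] :=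
  claw_free za zb zc ab ac bc;
  by rewrite // eqxx ?orbT.
Qed.

Definition meet : rel {set G} := fun A B =>
  [&& is_line A, is_line B, A != B & [exists z, (z \in A) && (z \in B)]].

(** Points where consecutive lines meet form an induced cycle, an odd hole once the length is at
    least 5. Lengths 1 and 3 are excluded separately. *)
Lemma meet_odd_cycle p : cycle meet p -> odd (size p) -> uniq p -> False.
Proof.
case: p => // L0 p cp op up; set n := size p; have {}op : odd n.+1 := op.
pose L (i : 'I_n.+1) := nth L0 (L0 :: p) i.
have LI : injective L.
  move=> i j /eqP; rewrite nth_uniq // => /eqP; exact: ord_inj.
have LS i : meet (L i) (L (ordS i)).
  move: cp => /(pathP L0)/(_ i); rewrite size_rcons => /(_ (ltn_ord i)).
  rewrite -rcons_cons nth_rcons /= ltn_ord nth_rcons -/n.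
  rewrite /L /=; have [ni|ni|ni] := ltngtP i n.
  - by rewrite modn_small.
  - by have := ltn_ord i; lia.
  - by rewrite ni modnn.
have Ll i : is_line (L i) by case/and4P: (LS i).
have /fin_all_exists[x xP] i : exists z, (z \in L i) /\ (z \in L (ordS i)).
  by case/and4P: (LS i) => _ _ _ /existsP[z /andP[]]; exists z.
have xL i : x i \in L i by case: (xP i).
have xLS i : x i \in L (ordS i) by case: (xP i).
have nS (i : 'I_n.+1) : ordS i != i.
  by case/and4P: (LS i) => _ _; rewrite (inj_eq LI) eq_sym.
(* [x i] already lies on the two lines [L i] and [L (ordS i)], hence on no third one. *)
have memL (i j : 'I_n.+1) : x i \in L j -> (i == j) || (ordS i == j).
  move=> xj; have := three_lines (Ll i) (Ll (ordS i)) (Ll j) (xL i) (xLS i) xj.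
  by rewrite !(inj_eq LI) eq_sym (negbTE (nS i)).
have n2 : 2 <= n.
  have /eqP n0 := nS ord0.
  have {}n0 : ordS (ord0 : 'I_n.+1) <> 0 :> nat by move=> E; apply/n0/ord_inj.
  by move: n0 op; rewrite val_ordS /=; case: (n) => [|[]].
have nSS (j : 'I_n.+1) : ordS (ordS j) != j.
  by apply/eqP => /(congr1 (@nat_of_ord _)); rewrite !val_ordS; do 2!case: eqP; lia.
have xI : injective x.
  move=> i j xij; have := memL i j; rewrite {1}xij xL => /(_ isT).
  have := memL i (ordS j); rewrite {1}xij xLS => /(_ isT).
  case/orP=> /eqP E1 /orP[]/eqP E2 //.
    by have := nSS j; rewrite -E1 E2 eqxx.
  by apply: (can_inj (@ordSK _)).
have adjS i : adj (x i) (x (ordS i)).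
  apply: (proj1 (two_points (Ll (ordS i)) _ _ _)) => //.
  by rewrite (inj_eq xI) eq_sym.
have xA (i j : 'I_n.+1) :
    adj (x i) (x j) = (i != j) && ((ordS i == j) || (ordS j == i)).
  apply/idP/idP => [ij|/andP[_ /orP[]/eqP<-]]; last 2 first.
  - exact: adjS.
  - by rewrite adj_sym.
  have nij : i != j by have := adj_neq ij; rewrite (inj_eq xI).
  rewrite nij /=.
  (* The line spanned by an edge [x i], [x j] passes through [x i], so it is [L i] or [L (ordS i)];
     [memL] for [x j] then makes [i] and [j] consecutive. *)
  have lij : is_line (line (x i) (x j)) by apply/is_lineP; exists (x i), (x j).
  have := three_lines (Ll i) (Ll (ordS i)) lij (xL i) (xLS i) (line_l ij).
  have xj : x j \in line (x i) (x j) by rewrite lineC line_l // adj_sym.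
  rewrite (inj_eq LI) [i == _]eq_sym (negbTE (nS i)) /=.
  case/orP=> /eqP E; rewrite -E in xj; have /orP[] := memL _ _ xj.
  - by rewrite eq_sym (negbTE nij).
  - by move=> ->; rewrite orbT.
  - by rewrite eq_sym => ->.
  - by rewrite (inj_eq (can_inj (@ordSK _))) eq_sym (negbTE nij).
have [n5|n5] := leqP 5 n.+1; first exact: (oddhole_free _ n5 xI xA).
(* Three lines remain. Their meeting points form a triangle, so the third point lies on the line
   through the other two, against [memL]. *)
have n3 : n = 2 by move: op n2 n5; case: (n) => [|[|[|[|]]]].
have SSS (j : 'I_n.+1) : ordS (ordS (ordS j)) = j.
  by apply: ord_inj; have := ltn_ord j; rewrite !val_ordS; do 3!case: eqP; lia.
pose j : 'I_n.+1 := ord0.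
have [_ LE] : adj (x j) (x (ordS j)) /\ L (ordS j) = line (x j) (x (ordS j)).
  by apply: two_points; rewrite // (inj_eq xI) eq_sym.
have : x (ordS (ordS j)) \in L (ordS j).
  have := adjS (ordS (ordS j)); rewrite SSS adj_sym => aSS.
  by rewrite LE inE adjS aSS !orbT.
by move/memL; rewrite SSS (negbTE (nS _)) eq_sym (negbTE (nS _)).
Qed.

Lemma free_splitting : exists k : G -> G -> bool, splitting k.
Proof.
have meetC : symmetric meet.
  move=> A B; rewrite /meet eq_sym andbCA; do 3!congr andb.
  by apply: eq_existsb => z; rewrite andbC.
have [c cP] := odd_cycle_free_bipartition meetC meet_odd_cycle.
exists (fun x y => c (line x y)); split=> [x y|y x z yx yz xz]; first by rewrite lineC.
have lx : x \in line y x by rewrite lineC line_l // adj_sym.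
have lz : z \in line y z by rewrite lineC line_l // adj_sym.
have [axz|naxz] := boolP (adj x z).
  rewrite (line_step yx (z := z)) ?eqxx //; last by rewrite eq_sym adj_neq.
  by rewrite inE yz axz !orbT.
(* The two lines meet in [y]; they differ, since two points of one line are adjacent. *)
apply/negbTE/cP/and4P; split.
- by apply/is_lineP; exists y, x.
- by apply/is_lineP; exists y, z.
- apply: contra naxz => /eqP E.
  by have [] := line_eq yx lx _ xz => //; rewrite E.
- by apply/existsP; exists y; rewrite !line_l.
Qed.
End Lines.

Theorem proposition15 (G : sgraph) :
  ((exists c : edge G -> colour, ec_free bipartite_line_patterns (ECGraph c))
   <-> (exists H : sgraph, bipartite H /\ isomorphic G (line_graph H)))
  /\
  ((exists H : sgraph, bipartite H /\ isomorphic G (line_graph H))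
   <-> free claw_diamond_oddhole G).
Proof.
split; split.
- by move=> [c /ec_free_splitting /splitting_line].
- by move=> [H [bH /(line_splitting bH)[k /splitting_ec_free]]].
- by move=> [H [bH /(line_splitting bH)[k /splitting_free]]].
- by move=> /free_splitting[k /splitting_line].
Qed.
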